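(* Let $m,n>1$ be integers such that $\mathbb{Z}_n$ is a $\mathbb{Z}_m$-module (equivalently, $n\mid m$). Then the graph $G_n(\mathbb{Z}_m)$ is planar if and only if there exist pairwise distinct primes $p_1,p_2,p_3$ and positive integers $\alpha_1,\alpha_2,\beta_1$ (only those occurring in the respective item being relevant) such that one of the following holds: (1) $m=p_1^{\alpha_1}$, $n=p_1^{\beta_1}$ and $\beta_1\leq 5$; (2) $m=p_1^{\alpha_1}p_2^{\alpha_2}$, $n=p_1$ and $\alpha_2\leq 4$; (3) $m=p_1^{\alpha_1}p_2$, $n=p_1^{2}$; (4) $m=p_1^{\alpha_1}p_2p_3$, $n=p_1$; (5) $m=p_1p_2^{\alpha_2}$, $n=p_1p_2^{2}$ and $\alpha_2\in\{2,3,4\}$; (6) $m=p_1p_2p_3$, $n=p_1p_2$; (7) $m=p_1^{\alpha_1}p_2^{\alpha_2}$, $n=p_1p_2$ and $\alpha_1,\alpha_2\leq 4$; (8) $m=n=p_1p_2p_3$.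
   Context: $\mathbb{Z}_k$ denotes the ring (or additive group) of integers modulo $k$. For integers $m,n>1$, $\mathbb{Z}_n$ is a $\mathbb{Z}_m$-module (with the natural action) if and only if $n$ divides $m$. Let $I(\mathbb{Z}_m)^*$ be the set of all non-zero proper ideals of $\mathbb{Z}_m$. The $\mathbb{Z}_n$-intersection graph of $\mathbb{Z}_m$, denoted $G_n(\mathbb{Z}_m)$, is the simple graph with vertex set $I(\mathbb{Z}_m)^*$ in which two distinct vertices $I,J$ are adjacent if and only if $I\mathbb{Z}_n\cap J\mathbb{Z}_n\neq 0$. A graph is planar if it can be drawn in the plane so that its edges intersect only at their ends; the graph with no vertices (which occurs when $m$ is prime) is allowed and counts as planar. *)

(* Defs.v *)
From HB Require Import structures.
From mathcomp Require Import all_boot all_order all_fingroup all_algebra.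
From mathcomp Require Import all_classical all_reals all_analysis.
Import Order.TTheory GRing.Theory Num.Theory.
Import numFieldNormedType.Exports.

Set Implicit Arguments.
Unset Strict Implicit.
Unset Printing Implicit Defensive.

Local Open Scope ring_scope.

Record sgraph := SGraph {
  vertex :> finType;
  adj : rel vertex;
  adj_sym : symmetric adj;
  adj_irr : irreflexive adj }.

Section Planarity.
Variable R : realType.
Local Open Scope classical_set_scope.

Definition is_arc (x y : R * R) (A : set (R * R)) : Prop :=
  exists g : R -> R * R,
    [/\ {within `[0, 1], continuous g}, {in `[0, 1] &, injective g},
        g 0 = x, g 1 = y & g @` `[0, 1] = A].

(* [edge u v] is only meaningful when [u] and [v] are adjacent. *)
Definition is_plane_drawing (G : sgraph) (pos : G -> R * R)
    (edge : G -> G -> set (R * R)) : Prop :=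
  [/\ injective pos,
      forall u v, adj u v ->
        edge u v = edge v u /\ is_arc (pos u) (pos v) (edge u v),
      forall u v w, adj u v -> edge u v (pos w) -> w = u \/ w = v
    & forall u v x y, adj u v -> adj x y ->
        [set u; v]%SET <> [set x; y]%SET ->
        edge u v `&` edge x y `<=`
          pos @` [set` ([set u; v] :&: [set x; y])%SET] ].

Definition planar (G : sgraph) : Prop :=
  exists pos edge, @is_plane_drawing G pos edge.

End Planarity.

Section IntersectionGraph.
Variables m n : nat.

(* The natural action, by the representative of [a] in [0, m[. *)
Definition Zact (a : 'Z_m) (x : 'Z_n) : 'Z_n := x *+ val a.

(* The axioms of [lmodType] for [Zact]. *)
Definition Z_module : Prop :=
  [/\ forall a b x, Zact a (Zact b x) = Zact (a * b) x,
      left_id 1 Zact,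
      right_distributive Zact +%R
    & forall x, {morph Zact^~ x : a b / a + b}].

(* [I Z_n]: [<<_>>] is the generated subgroup for the additive group structure
   of ['Z_n], i.e. the set of finite sums of products [a x]. *)
Definition ideal_smul (I : {set 'Z_m}) : {set 'Z_n} :=
  <<[set Zact a x | a in I, x in [set: 'Z_n]]>>%g.

(* [idealr_closed] includes properness ([1 \notin I]). *)
Definition nonzero_proper_ideal (I : {set 'Z_m}) : bool :=
  `[< idealr_closed I >] && (I != [set 0]).

Definition Zn_vertex : finType := {I : {set 'Z_m} | nonzero_proper_ideal I}.

Definition Zn_adj : rel Zn_vertex := fun I J =>
  (I != J) && (ideal_smul (val I) :&: ideal_smul (val J) != [set 0]).

Lemma Zn_adj_sym : symmetric Zn_adj.
Proof. by move=> I J; rewrite /Zn_adj eq_sym finset.setIC. Qed.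

Lemma Zn_adj_irr : irreflexive Zn_adj.
Proof. by move=> I; rewrite /Zn_adj eqxx. Qed.

Definition Zn_graph : sgraph := SGraph Zn_adj_sym Zn_adj_irr.

End IntersectionGraph.

Lemma Z_moduleP m n : (1 < m)%N -> (1 < n)%N -> Z_module m n <-> (n %| m)%N.
Proof.
move=> m1 n1.
have mE : (Zp_trunc m).+2 = m by exact: Zp_cast.
have nE : (Zp_trunc n).+2 = n by exact: Zp_cast.
have modE (nm : (n %| m)%N) k (x : 'Z_n) :
    x *+ (k %% (Zp_trunc m).+2) = x *+ k.
  rewrite mE {2}(divn_eq k m) mulrnDr -[x *+ (_ * _)]mulr_natr natrM.
  have -> : m%:R = 0 :> 'Z_n.
    by apply: val_inj; rewrite /= val_Zp_nat //; apply/eqP.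
  by rewrite !mulr0 add0r.
split=> [[_ act1 _ actD] | nm].
  have := actD 1 1 (- 1); rewrite subrr act1 /Zact mulr0n -mulrS.
  have -> : val (- 1 : 'Z_m) = m.-1.
    rewrite /= mE [(1 %% m)%N]modn_small // subn1 modn_small //.
    by rewrite ltn_predL (ltnW m1).
  rewrite prednK ?(ltnW m1) // => /esym /(congr1 val).
  by rewrite /= val_Zp_nat // => mn0; rewrite /dvdn mn0.
split.
- by move=> a b x; rewrite /Zact /= modE // -mulrnA mulnC.
- by move=> x; rewrite /Zact /= modE.
- by move=> a x y; rewrite /Zact mulrnDl.
- by move=> x a b; rewrite /Zact /= modE // mulrnDr.
Qed.

(* Main.v *)
Require Import Defs.
From mathcomp Require Import all_boot all_order all_fingroup all_algebra.
From mathcomp Require Import all_classical all_reals all_analysis.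
From mathcomp Require Import ring lra zify.
From Stdlib Require Import Btauto.
Import Order.TTheory GRing.Theory Num.Theory.
Import numFieldNormedType.Exports.

Set Implicit Arguments.
Unset Strict Implicit.
Unset Printing Implicit Defensive.

(** Every ideal of Z_m is generated by a divisor of m, and [dZ_m], [eZ_m] are
adjacent exactly when n does not divide lcm(d, e), that is, when some prime p
dividing n satisfies both v_p(d) < v_p(n) and v_p(e) < v_p(n).  Hence the graph
is a union of cliques, one for each prime p dividing n: writing m = p^a m' with
p prime to m', the clique of p consists of the p^i d with i < v_p(n), d | m',
except 1, and it has v_p(n) tau(m') - 1 vertices, where tau counts divisors.

If the graph is planar, none of these cliques contains K5
([planar_clique]), so v_p(n) tau(m') <= 5 for every p
([planar_divisor_bound]).  A number with at most five divisors is 1, a small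
power of a prime or a product of two primes ([few_divisors]), and working
through these shapes gives the eight families ([bounded_listed]).  Conversely,
in each family the non-isolated vertices form one K4, two K4's, a K4 and a
triangle with a common vertex, two triangles with a common vertex, or
three triangles pairwise sharing a vertex (or a subgraph of one of these), for
which a straight-line drawing with integer coordinates is written down
([listed_planar], [planar_straight]).

Edges being arbitrary arcs, the non-planarity of K5 is a topological fact; the
proof below is a discrete form of the van Kampen obstruction. If ab and cd are
disjoint edges, (s, t) |-> g_ab(s) - g_cd(t) has no zero on the unit square, so
it winds zero times along the boundary. Modulo 2 the winding is counted by the
crossings of the half-line y = 0, x > 0, along arcs sampled at finitely many
points. Each side of the square is an edge seen from a vertex, up to a sign
which only matters through the half-planes containing differences of vertices.
Summing the resulting relations over the 15 pairs of disjoint edges of K5, each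
edge-vertex term occurs twice, while the half-plane terms add up to 1
([K5_parity]). *)

(** * The parity obstruction for K5 *)

(** [c i j v] stands for the parity of the crossings of edge ij seen from v, and
[h i j] for the half-plane containing the vector from i to j.  In the sum of the
15 relations every [c i j v] appears twice, once for each edge joining v to one
of the two remaining vertices.  Every pair of vertices contributes six [h]
terms, so their sum does not depend on [h] and only counts the reversals
[h j i = ~~ h i j]; each of the five 4-subsets accounts for three of them. *)
Lemma K5_parity (c : nat -> nat -> nat -> bool) (h : nat -> nat -> bool) :
  (forall i j, i < j < 5 -> h j i = ~~ h i j) ->
  ~ (forall i j k l, i < j < 5 -> k < l < 5 -> uniq [:: i; j; k; l] ->
     c i j k (+) c i j l (+) (c k l i (+) c k l j) =
     h i k (+) h i l (+) (h j k (+) h j l)).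
Proof.
move=> hN rel.
pose E a b d e := c a b d (+) c a b e (+) (c d e a (+) c d e b) (+)
   (h a d (+) h a e (+) (h b d (+) h b e)).
have E0 i j k l : i < j < 5 -> k < l < 5 -> uniq [:: i; j; k; l] ->
    E i j k l = false.
  by move=> ij kl u; rewrite /E rel // addbb.
pose total :=
  E 0 1 2 3 (+) E 0 2 1 3 (+) E 0 3 1 2 (+)
  (E 0 1 2 4 (+) E 0 2 1 4 (+) E 0 4 1 2) (+)
  (E 0 1 3 4 (+) E 0 3 1 4 (+) E 0 4 1 3) (+)
  (E 0 2 3 4 (+) E 0 3 2 4 (+) E 0 4 2 3) (+)
  (E 1 2 3 4 (+) E 1 3 2 4 (+) E 1 4 2 3).
have total0 : total = false by rewrite /total !E0.
suff : total = true by rewrite total0.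
have xorE b b' : b (+) b' = xorb b b' by case: b; case: b'.
rewrite /total /E !(hN 1 2, hN 1 3, hN 1 4, hN 2 3, hN 2 4, hN 3 4) //.
rewrite {rel total total0 E E0 hN} !xorE.
do !let x := fresh in set x := c _ _ _; clearbody x.
do !let x := fresh in set x := h _ _; clearbody x.
btauto.
Qed.

(** * Separation and sampling of arcs *)

Section ArcsInThePlane.
Variable R : realType.
Local Open Scope ring_scope.
Local Open Scope classical_set_scope.

Implicit Types (z w : R * R) (f g : R -> R * R).

Lemma within_near f (e s : R) : {within `[0, 1], continuous f} -> 0 < e ->
  `[0, 1] s -> \forall t \near s, `[0, 1] t -> `|f s - f t| < e.
Proof.
move=> /subspace_continuousP cf e0 s01.
have /cvgrPdist_lt/(_ e e0) := cf _ s01.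
by rewrite near_withinE.
Qed.

Lemma arc_unif_continuous f (e : R) :
  {within `[0, 1], continuous f} -> 0 < e ->
  \forall d \near 0^'+, forall s, `[0, 1] s -> forall t,
    `[0, 1] t -> `|s - t| < d -> `|f s - f t| < e.
Proof.
move=> cf e0.
have /compact_near_coveringP/near_covering_withinP cpt :=
  @segment_compact R 0 1.
apply: (cpt _ (0 : R)^'+ (fun d s => forall t, `[0, 1] t -> `|s - t| < d ->
  `|f s - f t| < e)) => s s01.
have e20 : 0 < e / 2 by rewrite divr_gt0.
have /nbhs_ballP[/= r r0 rP] := within_near cf e20 s01.
near=> u d => u01 t t01 utd.
have su : `|s - u| < r / 2 by near: u; apply: nbhsx_ballx; rewrite divr_gt0.
have dr : d < r / 2 by near: d; apply: nbhs_right_lt; rewrite divr_gt0.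
rewrite (le_lt_trans (ler_distD (f s) _ _)) // (splitr e) ltrD //.
  rewrite distrC; apply: rP => //; rewrite /ball /= (lt_le_trans su) //.
  by rewrite ler_pdivrMr // ler_peMr ?ler1n // ltW.
apply: rP => //; rewrite /ball /= (le_lt_trans (ler_distD u _ _)) //.
by rewrite (splitr r) ltrD // (lt_trans utd).
Unshelve. all: by end_near. Qed.

(** Near (s, t) the distance stays above a third of its value at (s, t);
compactness of the square makes this local bound uniform. *)
Lemma disjoint_arcs_dist f g :
  {within `[0, 1], continuous f} -> {within `[0, 1], continuous g} ->
  (f @` `[0, 1]) `&` (g @` `[0, 1]) = set0 ->
  \forall e \near 0^'+, forall s t, `[0, 1] s -> `[0, 1] t -> e < `|f s - g t|.
Proof.
move=> cf cg fg0.
have /compact_near_coveringP/near_covering_withinP cpt :=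
  compact_setX (@segment_compact R 0 1) (@segment_compact R 0 1).
have := cpt _ (0 : R)^'+ (fun e st => e < `|f st.1 - g st.2|) _ _.
move=> /(_ (at_right_proper_filter _)) H.
have {}H : \forall e \near 0^'+,
   `[0, 1] `*` `[0, 1] `<=` (fun st => e < `|f st.1 - g st.2|).
  apply: H => -[s t] [/= s01 t01].
  have d0 : 0 < `|f s - g t|.
    rewrite normr_gt0 subr_eq0; apply/eqP => fgE.
    have : ((f @` `[0, 1]) `&` (g @` `[0, 1])) (f s).
      by split; [exists s | exists t].
    by rewrite fg0.
  set d := `|f s - g t| in d0 *.
  have d30 : 0 < d / 3 by rewrite divr_gt0.
  have fn : \forall st \near (s, t), `[0, 1] st.1 -> `|f s - f st.1| < d / 3.
    exact: cvg_fst (within_near cf d30 s01).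
  have gn : \forall st \near (s, t), `[0, 1] st.2 -> `|g t - g st.2| < d / 3.
    exact: cvg_snd (within_near cg d30 t01).
  near=> st e => -[/= u01 v01].
  have us : `|f s - f st.1| < d / 3 by move: u01; near: st.
  have vt : `|g t - g st.2| < d / 3 by move: v01; near: st.
  have ed : e < d / 3 by near: e; apply: nbhs_right_lt.
  rewrite ltNge; apply/negP => le.
  have : d < d; last by rewrite ltxx.
  rewrite {1}/d (le_lt_trans (ler_distD (f st.1) _ _)) //.
  rewrite (le_lt_trans (lerD (lexx _) (ler_distD (g st.2) _ _))) //.
  rewrite (distrC _ (g t)); lra.
apply: filterS H => e H s t s01 t01.
exact: (H (s, t)).
Unshelve. all: by end_near. Qed.

(** * Crossings of a half-line, modulo 2 *)

Lemma normR2_lt z (e : R) : (`|z| < e) = (`|z.1| < e) && (`|z.2| < e).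
Proof. by rewrite prod_normE gt_max. Qed.

(** The open upper half-plane together with the half-line y = 0, x > 0, so that
exactly one of z and -z belongs to it when z is not 0. *)
Definition upper z : bool := (0 < z.2) || (z.2 == 0) && (0 < z.1).

Lemma upperN z : z != 0 -> upper (- z) = ~~ upper z.
Proof.
case: z => x y; rewrite /upper /= !oppr_gt0 oppr_eq0 -pair_eqE /=.
by case: (ltrgtP y 0) => //=; case: (ltrgtP x 0) => //=; lra.
Qed.

(** Whether a short step from z to w crosses the half-line y = 0, x > 0.  No
intersection point is computed: when the step is shorter than the norm of z and
changes half-plane, the sign of the abscissa is constant near z. *)
Definition crossing z w : bool := (upper z != upper w) && (0 < z.1).

Lemma upper_jump z w : upper z != upper w -> `|z.2| <= `|z.2 - w.2|.
Proof.
case: z w => [x y] [x' y']; rewrite /upper /=.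
case: (ltrgtP y 0); case: (ltrgtP y' 0) => //= h1 h2 _;
rewrite ?h1 ?h2 ?normr0 ?subr0 //.
  rewrite ltr0_norm // ltr0_norm; lra.
rewrite gtr0_norm // gtr0_norm; lra.
Qed.

(** A short step that changes half-plane takes place near the x-axis, hence far
from the y-axis, because z is far from 0. *)
Lemma same_side z w u (e : R) : upper z != upper w ->
  e <= `|z| -> `|z - w| < e -> `|z - u| < e -> (0 < u.1) = (0 < z.1).
Proof.
move=> /upper_jump jump; rewrite leNgt !normR2_lt /=.
move=> h /andP[_ zw] /andP[zu _].
have z2e : `|z.2| < e by rewrite (le_lt_trans jump).
move: h; rewrite z2e andbT -leNgt => ez.
have := lt_le_trans zu ez.
case: (ltrgtP z.1 0) => [z0|z0|->].
- by rewrite (ltr0_norm z0) ltr_norml; lra.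
- by rewrite (gtr0_norm z0) ltr_norml; lra.
- by rewrite normr0 normr_lt0.
Qed.

(** A step changes half-plane by crossing either the half-line x > 0 or its
opposite, and the latter is what the opposite step crosses at x > 0. *)
Lemma crossing_opp z w (e : R) : 0 < e -> e <= `|z| -> e <= `|w| ->
  `|z - w| < e ->
  crossing (- z) (- w) = crossing z w (+) (upper z (+) upper w).
Proof.
move=> e0 ez ew zw; rewrite /crossing !upperN; last 2 first.
- by rewrite -normr_gt0 (lt_le_trans e0).
- by rewrite -normr_gt0 (lt_le_trans e0).
case: (upper z =P upper w) => [->|/eqP d].
  by rewrite addbb eqxx.
have -> : ~~ upper z != ~~ upper w by move: d; do 2!case: upper.
have -> : upper z (+) upper w by move: d; do 2!case: upper.
have : z.1 != 0.
  apply/negP => /eqP z0.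
  have := ez; rewrite leNgt normR2_lt z0 normr0 e0 /=.
  move: zw; rewrite normR2_lt => /andP[_ zw].
  by rewrite (le_lt_trans (upper_jump d)).
rewrite /= oppr_gt0; case: ltrgtP => //.
Qed.

(** A small cell far from 0 either stays in one half-plane, and nothing is
crossed, or stays on one side of the y-axis; there [crossing] is either always
false or the coboundary of [upper]. *)
Lemma crossing_cell z1 z2 z3 z4 (e : R) :
  e <= `|z1| -> e <= `|z2| -> e <= `|z3| -> e <= `|z4| ->
  `|z1 - z2| < e -> `|z2 - z3| < e -> `|z4 - z3| < e ->
  `|z1 - z4| < e -> `|z1 - z3| < e -> `|z2 - z4| < e ->
  crossing z1 z2 (+) crossing z4 z3 = crossing z1 z4 (+) crossing z2 z3.
Proof.
move=> e1 e2 e3 e4 d12 d23 d43 d14 d13 d24.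
have [uE|] := boolP [&& upper z1 == upper z2, upper z2 == upper z3
                      & upper z4 == upper z3].
  case/and3P: uE => /eqP uE /eqP uE' /eqP uE''.
  by rewrite /crossing uE uE' uE'' eqxx.
rewrite !negb_and.
have fin b : (0 < z1.1) = b -> (0 < z2.1) = b -> (0 < z3.1) = b ->
    (0 < z4.1) = b ->
   crossing z1 z2 (+) crossing z4 z3 = crossing z1 z4 (+) crossing z2 z3.
  by rewrite /crossing => -> -> _ ->; case: b; do 4!case: upper.
case/or3P => u.
- by apply: (fin (0 < z1.1)) => //; apply: (same_side u e1 d12).
- by apply: (fin (0 < z2.1)) => //; apply: (same_side u e2 d23);
    rewrite // distrC.
- by apply: (fin (0 < z4.1)) => //; apply: (same_side u e4 d43);
    rewrite // distrC.
Qed.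

Definition crossings N (p : nat -> R * R) : bool :=
  \big[addb/false]_(i < N) crossing (p i) (p i.+1).

Lemma crossings0 p : crossings 0 p = false.
Proof. exact: big_ord0. Qed.

Lemma crossingsS N p :
  crossings N.+1 p = crossings N p (+) crossing (p N) (p N.+1).
Proof. exact: big_ord_recr. Qed.

(** Discrete form of: a map from a square to the plane minus 0 has winding
number zero along the boundary.  The cell relations are added up, row by row. *)
Lemma crossings_grid N (F : nat -> nat -> R * R) (e : R) :
  (forall i j, (i <= N)%N -> (j <= N)%N -> e <= `|F i j|) ->
  (forall i j i' j', (i <= N)%N -> (j <= N)%N -> (i' <= N)%N -> (j' <= N)%N ->
    (i <= i'.+1)%N -> (i' <= i.+1)%N -> (j <= j'.+1)%N -> (j' <= j.+1)%N ->
    `|F i j - F i' j'| < e) ->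
  crossings N (F^~ 0) (+) crossings N (F^~ N) =
  crossings N (F 0) (+) crossings N (F N).
Proof.
move=> Fe Fd.
suff H k l : (k <= N)%N -> (l <= N)%N ->
   crossings k (F^~ 0%N) (+) crossings k (F^~ l) =
   crossings l (F 0%N) (+) crossings l (F k) by exact: H.
elim: l k => [|l IH] k kN lN.
  by rewrite addbb !crossings0.
suff row : crossings k (F^~ l) (+) crossings k (F^~ l.+1) =
    crossing (F 0 l) (F 0 l.+1) (+) crossing (F k l) (F k l.+1).
  rewrite !crossingsS.
  rewrite addbACA -IH // 1?ltnW // -row.
  by rewrite addbA -(addbA (crossings _ _)) addbb addbF.
elim: k kN => [|k IHk] kN; first by rewrite addbb !crossings0.
rewrite !crossingsS addbACA [X in X (+) _]IHk 1?ltnW //.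
rewrite -(addbA _ _ (_ (+) _)); congr (_ (+) _).
rewrite (@crossing_cell _ _ _ _ e).
 by rewrite addKb.
all: first [apply: Fe | apply: Fd]; lia.
Qed.

Lemma crossings_opp N (p : nat -> R * R) (e : R) : 0 < e ->
  (forall i, (i <= N)%N -> e <= `|p i|) ->
  (forall i, (i < N)%N -> `|p i - p i.+1| < e) ->
  crossings N (fun i => - p i) =
  crossings N p (+) (upper (p 0) (+) upper (p N)).
Proof.
move=> e0; elim: N => [|N IH] pe pd; first by rewrite !crossings0 addbb.
rewrite !crossingsS IH; last 2 first.
- by move=> i iN; apply: pe; lia.
- by move=> i iN; apply: pd; lia.
rewrite (crossing_opp e0) ?pe ?pd // -!addbA; congr (_ (+) _).
rewrite (addbCA (upper (p N))) [in RHS]addbCA; congr (_ (+) _).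
by rewrite addKb.
Qed.

(** The grid relation for F i j = p i - q j.  On two of its sides p is constant
and F is the opposite of q seen from an end of p, hence the [upper] terms, by
[crossings_opp]. *)
Lemma crossings_disjoint N (p q : nat -> R * R) (e : R) : 0 < e ->
  (forall i j, (i <= N)%N -> (j <= N)%N -> e <= `|p i - q j|) ->
  (forall i, (i < N)%N -> `|p i - p i.+1| < e / 2) ->
  (forall i, (i < N)%N -> `|q i - q i.+1| < e / 2) ->
  crossings N (fun i => p i - q 0) (+) crossings N (fun i => p i - q N)
   (+) (crossings N (fun j => q j - p 0) (+) crossings N (fun j => q j - p N)) =
  upper (q 0 - p 0) (+) upper (q N - p 0)
   (+) (upper (q 0 - p N) (+) upper (q N - p N)).
Proof.
move=> e0 pq dp dq.
have near1 r : (forall i, (i < N)%N -> `|r i - r i.+1| < e / 2) ->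
   forall i i', (i <= N)%N -> (i' <= N)%N -> (i <= i'.+1)%N -> (i' <= i.+1)%N ->
   `|r i - r i'| < e / 2.
  move=> dr i i' iN i'N ii' i'i.
  have [E|[E|E]] : i' = i \/ i' = i.+1 \/ i = i'.+1 by lia.
  - by rewrite E subrr normr0 divr_gt0.
  - by rewrite E; apply: dr; lia.
  - by rewrite E distrC; apply: dr; lia.
have := @crossings_grid N (fun i j => p i - q j) e pq _.
have flip i : (i <= N)%N -> crossings N (fun j => p i - q j) =
    crossings N (fun j => q j - p i)
      (+) (upper (q 0 - p i) (+) upper (q N - p i)).
  move=> iN; rewrite -(@crossings_opp _ _ e) //.
  - by apply: eq_bigr => j _; rewrite !opprB.
  - by move=> j jN; rewrite distrC pq.
  - move=> j jN; rewrite opprB addrA subrK.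
    by rewrite (lt_trans (dq _ jN)) // ltr_pdivrMr // ltr_pMr // ltr1n.
rewrite !flip //= => ->.
  have xorKK (a b : bool) : a (+) b (+) a = b by case: a; case: b.
  by rewrite addbACA addbC !xorKK addbC.
move=> i j i' j' iN jN i'N j'N *.
rewrite opprB (addrC (q j')) addrACA (addrC (- q j)).
rewrite (le_lt_trans (ler_normD _ _)) // [ltRHS]splitr ltrD // ?near1 //.
Qed.

(** Edges without a common end are disjoint compact sets, so their distances
have a common lower bound e; all edges are sampled at N+2 points, N being
such that every edge moves by less than e / 2 in one step. The sampled edges
of a K5 then satisfy the relations excluded by [K5_parity]. *)
Lemma planar_clique (G : sgraph) (s : seq G) :
  planar R G -> pairwise (@adj G) s -> (size s <= 4)%N.
Proof.
case=> pos [edge [posI arcs _ disj]] clique; rewrite leqNgt; apply/negP => s5.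
have x0 : G by case: s s5 {clique}.
pose x i := nth x0 s i.
have adjx i j : (i < j < 5)%N -> adj (x i) (x j).
  move=> /andP[ij j5]; apply: (pairwiseP x0 clique) => //.
  - by rewrite inE (ltn_trans ij) // (leq_trans j5).
  - by rewrite inE (leq_trans j5).
have xinj i j : (i < 5)%N -> (j < 5)%N -> (x i == x j) = (i == j).
  move=> i5 j5; apply/eqP/eqP => [|->//].
  case: (ltngtP i j) => // ij xE.
  - by have := adjx i j; rewrite ij j5 => /(_ isT); rewrite xE adj_irr.
  - by have := adjx j i; rewrite ij i5 => /(_ isT); rewrite xE adj_irr.
have /choice[g gP] (ij : 'I_5 * 'I_5) : exists g, (ij.1 < ij.2)%N ->
    [/\ {within `[0, 1], continuous g}, g 0 = pos (x ij.1),
     g 1 = pos (x ij.2) & g @` `[0, 1] = edge (x ij.1) (x ij.2)].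
  case: ij => i j /=; have [ij|] := boolP (i < j)%N; last by exists (fun=> 0).
  have /arcs[_ [g [? ? ? ? ?]]] : adj (x i) (x j) by apply: adjx; rewrite ij /=.
  by exists g.
have [e [e0 eP]] : exists e : R, 0 < e /\ forall ij kl : 'I_5 * 'I_5,
   (ij.1 < ij.2)%N -> (kl.1 < kl.2)%N ->
   uniq [:: ij.1 : nat; ij.2 : nat; kl.1 : nat; kl.2 : nat] ->
   forall s t, `[0, 1] s -> `[0, 1] t -> e < `|g ij s - g kl t|.
  suff dist : \forall e \near (0 : R)^'+, forall ij kl : 'I_5 * 'I_5,
     (ij.1 < ij.2)%N -> (kl.1 < kl.2)%N ->
     uniq [:: ij.1 : nat; ij.2 : nat; kl.1 : nat; kl.2 : nat] ->
     forall s t, `[0, 1] s -> `[0, 1] t -> e < `|g ij s - g kl t|.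
    have [e [e0 eP]] := filter_ex (filterI (nbhs_right_gt (0 : R)) dist).
    by exists e.
  apply: filter_forall => -[i j]; apply: filter_forall => -[k l] /=.
  have [H|H] := boolP [&& (i < j)%N, (k < l)%N
      & uniq [:: i : nat; j : nat; k : nat; l : nat]]; last first.
    by apply: nearW => e ij kl u; case/negP: H; rewrite ij kl; exact: u.
  have /and3P[ij kl u] := H.
  have [cg _ _ gE] := gP (i, j) ij; have [cg' _ _ gE'] := gP (k, l) kl.
  apply: filterS (disjoint_arcs_dist cg cg' _) => [e eP _ _ _ //|].
  have /and4P[/negbTE ik /negbTE il /negbTE jk /negbTE jl] :
      [&& i != k :> nat, i != l :> nat, j != k :> nat & j != l :> nat].
    move: u; rewrite /= !inE !negb_or.
    by move=> /and4P[/and3P[_ -> ->] /andP[-> ->] _ _].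
  rewrite {}gE {}gE' -subset0; apply: subset_trans.
    apply: disj; [by apply: adjx; rewrite ij /=|by apply: adjx; rewrite kl /=|].
    move=> /setP/(_ (x i)); rewrite !inE eqxx !xinj //.
    by rewrite ik il.
  move=> z [w]; rewrite /= !inE => /andP[/orP[]/eqP-> /orP[]];
    by rewrite xinj // ?ik ?il ?jk ?jl.
have [d [d0 dP]] : exists d : R, 0 < d /\ forall ij : 'I_5 * 'I_5,
   (ij.1 < ij.2)%N -> forall s, `[0, 1] s -> forall t, `[0, 1] t ->
    `|s - t| < d -> `|g ij s - g ij t| < e / 2.
  suff unif : \forall d \near (0 : R)^'+, forall ij : 'I_5 * 'I_5,
     (ij.1 < ij.2)%N -> forall s, `[0, 1] s -> forall t, `[0, 1] t ->
      `|s - t| < d -> `|g ij s - g ij t| < e / 2.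
    have [d [d0 dP]] := filter_ex (filterI (nbhs_right_gt (0 : R)) unif).
    by exists d.
  apply: filter_forall => -[i j] /=.
  have [ij|_] := boolP (i < j)%N; last by apply: nearW.
  have [cg _ _ _] := gP (i, j) ij.
  have e20 : 0 < e / 2 by rewrite divr_gt0.
  by apply: filterS (arc_unif_continuous cg e20) => d dP _.
have [N Nd] : exists N, N.+1%:R^-1 < d.
  exact: filter_ex (near_infty_natSinv_lt (PosNum d0)).
pose pt (i : nat) : R := i%:R / N.+1%:R.
have pt01 i : (i <= N.+1)%N -> `[0, 1] (pt i).
  by move=> iN; rewrite /= in_itv /= divr_ge0 //= ler_pdivrMr // mul1r ler_nat.
have ptS i : `|pt i - pt i.+1| < d.
  rewrite -mulrBl -natr1 opprD addrA subrr add0r mulN1r normrN.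
  by rewrite gtr0_norm // invr_gt0.
pose p i j k := g (inord i, inord j) (pt k).
apply: (@K5_parity (fun i j v => crossings N.+1 (fun k => p i j k - pos (x v)))
   (fun i j => upper (pos (x j) - pos (x i)))).
  move=> i j /andP[ij j5]; rewrite -upperN ?opprB // subr_eq0.
  apply/negP => /eqP/posI/eqP; rewrite xinj ?gtn_eqF //; lia.
move=> i j k l ij kl u.
have /andP[ij' j5] := ij; have /andP[kl' l5] := kl.
have [i5 k5] : (i < 5)%N /\ (k < 5)%N by lia.
have pt0 : pt 0 = 0 by rewrite /pt mul0r.
have pt1 : pt N.+1 = 1 by rewrite /pt divff // pnatr_eq0.
have ord_lt a b : (a < b)%N -> (b < 5)%N ->
    ((inord a : 'I_5) < (inord b : 'I_5))%N.
  by move=> ab b5; rewrite !inordK //; lia.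
have ends a b : (a < b)%N -> (b < 5)%N ->
    p a b 0 = pos (x a) /\ p a b N.+1 = pos (x b).
  move=> ab b5; have [_ g0 g1 _] := gP (inord a, inord b) (ord_lt _ _ ab b5).
  by rewrite /p pt0 pt1 g0 g1 /= !inordK //; lia.
have steps a b : (a < b)%N -> (b < 5)%N ->
    forall r, (r < N.+1)%N -> `|p a b r - p a b r.+1| < e / 2.
  by move=> ab b5 r rN; apply: dP; rewrite ?ord_lt //; apply: pt01; lia.
have [pij0 pij1] := ends _ _ ij' j5; have [pkl0 pkl1] := ends _ _ kl' l5.
have := @crossings_disjoint N.+1 (p i j) (p k l) e e0.
rewrite pij0 pij1 pkl0 pkl1; apply; [|exact: steps|exact: steps].
move=> r s' rN sN; apply/ltW/eP; rewrite ?ord_lt ?inordK //; exact: pt01.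
Unshelve. all: by rewrite ltr0n. Qed.
End ArcsInThePlane.

(** * Straight-line drawings *)

Section StraightLine.
Local Open Scope ring_scope.

Definition orient (S : comPzRingType) (a b c : S * S) : S :=
  (b.1 - a.1) * (c.2 - a.2) - (b.2 - a.2) * (c.1 - a.1).

(** A decidable criterion for the straight-line drawing of the graph [T] on [s]
with vertices at [P]: the points are in general position and, for any two
disjoint edges, one of them lies strictly on one side of the line through the
other.  The bound on ordinates leaves a half-plane for isolated
vertices. *)
Definition straight_ok (L : eqType) (s : seq L) (P : L -> int * int)
    (T : rel L) : bool :=
  [&& all2rel (fun a b => (P a == P b) ==> (a == b)) s,
      all (fun l => 0 <= (P l).2) s,
      all (fun a => all (fun b => all (fun c =>
        uniq [:: a; b; c] ==> (orient (P a) (P b) (P c) != 0)) s) s) s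
    & all (fun a => all (fun b => T a b ==> all (fun c => all (fun d =>
        uniq [:: a; b; c; d] && T c d ==>
        ((0 < orient (P a) (P b) (P c) * orient (P a) (P b) (P d)) ||
         (0 < orient (P c) (P d) (P a) * orient (P c) (P d) (P b))))
        s) s) s) s].

Variable R : realType.
Implicit Types a b c d : R * R.

Definition along a b (t : R) : R * R :=
  (a.1 + t * (b.1 - a.1), a.2 + t * (b.2 - a.2)).

Definition segment a b : set (R * R) := (along a b @` `[0, 1])%classic.

Lemma segmentC a b : segment a b = segment b a.
Proof.
suff sub x y : (segment x y `<=` segment y x)%classic.
  by apply/seteqP; split; apply: sub.
move=> _ [t t01 <-]; exists (1 - t).
  by move: t01; rewrite /= !in_itv /=; lra.
by rewrite /along; congr pair; ring.
Qed.

Lemma segment_arc a b : a <> b -> is_arc a b (segment a b).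
Proof.
move=> ab; exists (along a b); split => //.
- apply: continuous_subspaceT => t.
  have line (p q : R) : (p + x * q @[x --> t] --> p + t * q)%classic.
    apply: cvgD; first exact: cvg_cst.
    by apply: cvgM; [exact: cvg_id | exact: cvg_cst].
  exact: (cvg_pair (line _ _) (line _ _)).
- move=> t t' _ _ [/eqP e1 /eqP e2]; apply/eqP; apply: contra_notT ab => tt'.
  have tt0 : t - t' != 0 by rewrite subr_eq0.
  rewrite [a]surjective_pairing [b]surjective_pairing; congr pair; apply/eqP.
  + move: e1; rewrite (inj_eq (addrI _)) -subr_eq0 -mulrBl mulf_eq0.
    by rewrite (negbTE tt0) /= subr_eq0 eq_sym.
  + move: e2; rewrite (inj_eq (addrI _)) -subr_eq0 -mulrBl mulf_eq0.
    by rewrite (negbTE tt0) /= subr_eq0 eq_sym.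
- by rewrite /along !mul0r !addr0 -surjective_pairing.
- by rewrite /along !mul1r !(addrC a.1) !(addrC a.2) !subrK -surjective_pairing.
Qed.

Lemma orient_along a b c d t :
  orient a b (along c d t) = (1 - t) * orient a b c + t * orient a b d.
Proof. by rewrite /orient /along /=; ring. Qed.

Lemma segment_orient0 a b c : segment a b c -> orient a b c = 0.
Proof.
by move=> [t _ <-]; rewrite orient_along /orient; ring.
Qed.

(** On a segment lying strictly on one side of the line ab, the orientation with
respect to a and b is a convex combination of numbers of the same sign. *)
Lemma segment_disjoint a b c d z :
  0 < orient a b c * orient a b d -> segment a b z -> ~ segment c d z.
Proof.
move=> pos /segment_orient0 + [t t01 zE]; rewrite -{}zE orient_along.
move: t01; rewrite /= in_itv /= => /andP[t0 t1].
move: pos; set u := orient _ _ _; set v := orient _ _ _ => uv E.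
have : 0 < (1 - t) * (u * u) + t * (u * v).
  have u0 : u != 0 by apply: contraTneq uv => ->; rewrite mul0r ltxx.
  have uu : 0 < u * u by rewrite -expr2 exprn_even_gt0.
  have [t_lt1|t_ge1] := ltP t 1.
    by apply: ltr_wpDr; [apply/mulr_ge0/ltW | rewrite mulr_gt0 ?subr_gt0].
  apply: ltr_wpDl; first by rewrite mulr_ge0 ?subr_ge0 // ltW.
  by rewrite mulr_gt0 // (lt_le_trans ltr01).
suff -> : (1 - t) * (u * u) + t * (u * v) = u * ((1 - t) * u + t * v).
  by rewrite E mulr0 ltxx.
ring.
Qed.

(** A point of both segments is collinear with a and b, while the orientation of
a, b and a moving point of ac is proportional to the parameter. *)
Lemma segment_share a b c z : orient a b c != 0 ->
  segment a b z -> segment a c z -> z = a.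
Proof.
move=> abc /segment_orient0 + [t _ zE]; rewrite -zE orient_along.
have -> : orient a b a = 0 by rewrite /orient; ring.
rewrite mulr0 add0r => /eqP; rewrite mulf_eq0 (negbTE abc) orbF => /eqP->.
by rewrite /along !mul0r !addr0 -surjective_pairing.
Qed.

Lemma segment_y_ge0 a b z : 0 <= a.2 -> 0 <= b.2 -> segment a b z -> 0 <= z.2.
Proof.
move=> a0 b0 [t + <-]; rewrite /= in_itv /= => /andP[t0 t1].
have -> : a.2 + t * (b.2 - a.2) = (1 - t) * a.2 + t * b.2 by ring.
by rewrite addr_ge0 // mulr_ge0 // subr_ge0.
Qed.

Definition int_point (p : int * int) : R * R := (p.1%:~R, p.2%:~R).

Lemma orient_int p q r :
  orient (int_point p) (int_point q) (int_point r) = (orient p q r)%:~R.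
Proof. by rewrite /orient /= -!rmorphB -!rmorphM -rmorphB. Qed.

Lemma int_point_inj : injective int_point.
Proof. by move=> [p q] [r s] [/intr_inj-> /intr_inj->]. Qed.

(** Vertices labelled outside [s] are isolated; they are placed on the line
y = -1, below the whole drawing, at abscissas given by their rank. *)
Lemma planar_straight (G : sgraph) (L : eqType) (lab : G -> L) (s : seq L)
    (P : L -> int * int) (T : rel L) :
  injective lab ->
  (forall u v, adj u v -> [&& lab u \in s, lab v \in s & T (lab u) (lab v)]) ->
  straight_ok s P T -> planar R G.
Proof.
move=> labI labP /and4P[/allrelP sP /allP y0 /allP gen /allP cross].
have PI : {in s &, injective P}.
  by move=> a b sa sb /eqP E; apply/eqP; move: (sP _ _ sa sb); rewrite E.
pose pos u := if lab u \in s then int_point (P (lab u))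
              else ((enum_rank u)%:R, - 1).
have posE u : lab u \in s -> pos u = int_point (P (lab u)).
  by rewrite /pos => ->.
have posI : injective pos.
  move=> u v; rewrite /pos; case: ifP => us; case: ifP => vs.
  - by move=> /int_point_inj/PI/labI; apply.
  - by case=> _ E; have := y0 _ us; rewrite -(ler0z R) E lerNr oppr0 ler10.
  - by case=> _ E; have := y0 _ vs; rewrite -(ler0z R) -E lerNr oppr0 ler10.
  - by case=> /eqP; rewrite eqr_nat => /eqP /val_inj/enum_rank_inj.
have genR u v w : lab u \in s -> lab v \in s -> lab w \in s ->
    uniq [:: u; v; w] -> orient (pos u) (pos v) (pos w) != 0.
  move=> us vs ws uvw; rewrite !posE // orient_int intr_eq0.
  have /allP/(_ _ vs)/allP/(_ _ ws)/implyP := gen _ us; apply.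
  by rewrite -[[:: lab u; _; _]]/(map lab [:: u; v; w]) map_inj_uniq.
exists pos, (fun u v => segment (pos u) (pos v)); split => //.
- move=> u v uv; split; first exact: segmentC.
  by apply: segment_arc => /posI E; rewrite E adj_irr in uv.
- move=> u v w uv; have /and3P[us vs _] := labP _ _ uv => wuv.
  have [|wu] := eqVneq w u; first by left.
  have [|wv] := eqVneq w v; first by right.
  exfalso.
  have [ws|ws] := boolP (lab w \in s).
    suff /(genR u v w us vs ws) : uniq [:: u; v; w].
      by rewrite segment_orient0 // eqxx.
    rewrite /= !inE negb_or !(eq_sym _ w) wu wv !andbT.
    by apply: contraTneq uv => ->; rewrite adj_irr.
  have : 0 <= (pos w).2.
    by apply: segment_y_ge0 wuv; rewrite posE //= ler0z y0.
  by rewrite /pos (negbTE ws) /= lerNr oppr0 ler10.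
have share u v w z : adj u v -> adj u w -> v != w ->
    segment (pos u) (pos v) z -> segment (pos u) (pos w) z -> z = pos u.
  move=> uv uw vw; apply: segment_share.
  have /and3P[us vs _] := labP _ _ uv; have /and3P[_ ws _] := labP _ _ uw.
  apply: genR => //; rewrite /= !inE negb_or vw !andbT.
  by apply/andP; split; [apply: contraTneq uv | apply: contraTneq uw] => ->;
    rewrite adj_irr.
have share' u v x y w z : adj u v -> adj x y ->
    [set u; v]%SET <> [set x; y]%SET ->
    w \in [set u; v]%SET -> w \in [set x; y]%SET ->
    segment (pos u) (pos v) z -> segment (pos x) (pos y) z -> z = pos w.
  move=> uv xy ne.
  have [vu yx] : adj v u /\ adj y x by rewrite adj_sym uv adj_sym.
  rewrite !inE => /orP[]/eqP E /orP[]/eqP E'; subst.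
  + by apply: share => //; apply: contra_notN ne => /eqP->.
  + rewrite [segment (pos x) _]segmentC; apply: share => //.
    by apply: contra_notN ne => /eqP->; rewrite finset.setUC.
  + rewrite segmentC; apply: share => //.
    by apply: contra_notN ne => /eqP->; rewrite finset.setUC.
  + rewrite segmentC [segment (pos x) _]segmentC; apply: share => //.
    by apply: contra_notN ne => /eqP->.
(* edges without a common end are kept apart by the separation criterion *)
move=> u v x y uv xy ne z [/= zuv zxy].
have [/eqP I0|/finset.set0Pn[w]] :=
  boolP (([set u; v] :&: [set x; y])%SET == finset.set0); last first.
  rewrite inE => /andP[wuv wxy]; exists w; last first.
    by symmetry; apply: (share' u v x y).
  by rewrite /= inE wuv.
exfalso.
have /and3P[us vs Tuv] := labP _ _ uv; have /and3P[xs ys Txy] := labP _ _ xy.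
have /allP/(_ _ vs)/implyP/(_ Tuv)/allP/(_ _ xs)/allP/(_ _ ys)/implyP :=
  cross _ us.
rewrite Txy andbT.
rewrite -[[:: lab u; _; _; _]]/(map lab [:: u; v; x; y]) map_inj_uniq //.
have dis (g h : G) : g \in [set u; v]%SET -> h \in [set x; y]%SET -> g != h.
  move=> guv hxy; apply/eqP => E; rewrite -{h}E in hxy.
  by have := finset.in_set0 g; rewrite -I0 inE guv hxy.
have uq : uniq [:: u; v; x; y].
  have adj_ne (a b : G) : adj a b -> a != b.
    by move=> ab; apply: contraTneq ab => ->; rewrite adj_irr.
  rewrite /= !inE !negb_or (adj_ne _ _ uv) (adj_ne _ _ xy) !andbT /=.
  by rewrite !dis // !inE eqxx ?orbT.
move=> /(_ uq)/orP[].
- rewrite -(ltr0z R) rmorphM /= -!orient_int -!posE // => o.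
  exact: segment_disjoint o zuv zxy.
- rewrite -(ltr0z R) rmorphM /= -!orient_int -!posE // => o.
  exact: segment_disjoint o zxy zuv.
Qed.
End StraightLine.

(** * Ideals of Z_m as divisors of m *)

Section Ideals.
Local Open Scope ring_scope.

(** The generator d is the least positive integer whose class is in [I]. *)
Lemma ideal_gen m (I : {set 'Z_m}) : (1 < m)%N -> idealr_closed I ->
    I != [set 0]%SET ->
  exists d, [/\ (1 < d < m)%N, (d %| m)%N
    & forall x, (x \in I) = (d %| val x)%N].
Proof.
move=> m1 [I0 I1 Iadd] Inz.
have mul a x : x \in I -> a * x \in I by move=> xI; rewrite -[_ * _]addr0 Iadd.
have modI k d : k%:R \in I -> d%:R \in I -> ((k %% d)%:R : 'Z_m) \in I.
  move=> kI dI; have -> : (k %% d)%:R = - (k %/ d)%:R * d%:R + k%:R :> 'Z_m.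
    by rewrite {3}(divn_eq k d) natrD natrM mulNr addKr.
  exact: Iadd.
have ltm (x : 'Z_m) : (val x < m)%N.
  by rewrite -[X in (_ < X)%N](Zp_cast m1) ltn_ord.
have [x xI x0] : exists2 x, x \in I & x != 0.
  have : ~~ (I \subset [set 0]%SET).
    apply: contra Inz => sub; rewrite finset.eqEsubset sub /=.
    by apply/fintype.subsetP => y; rewrite inE => /eqP->.
  by case/fintype.subsetPn => x xI; rewrite inE => x0; exists x.
have ex : exists k, (0 < k)%N && ((k%:R : 'Z_m) \in I).
  by exists (val x); rewrite lt0n natr_Zp xI andbT; exact: x0.
case: (ex_minnP ex) => d /andP[d0 dI] dmin.
have dP k : ((k%:R : 'Z_m) \in I) = (d %| k)%N.
  apply/idP/idP => [kI|/dvdnP[q ->]]; last by rewrite natrM mul.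
  rewrite /dvdn -leqn0 leqNgt; apply/negP => r0.
  have := dmin (k %% d)%N.
  by rewrite r0 modI //= leqNgt ltn_pmod // => /(_ isT).
exists d; split.
- apply/andP; split.
    rewrite ltn_neqAle d0 andbT; apply: contraNneq I1 => d1.
    by move: dI; rewrite -d1.
  apply: (leq_ltn_trans _ (ltm x)); apply: dmin.
  by rewrite lt0n natr_Zp xI andbT; exact: x0.
- by rewrite -dP pchar_Zp.
- by move=> y; rewrite -{1}(natr_Zp y) dP.
Qed.

Lemma dvd_ideal m d : (1 < m)%N -> (1 < d < m)%N -> (d %| m)%N ->
  nonzero_proper_ideal [set x : 'Z_m | (d %| val x)%N]%SET.
Proof.
move=> m1 /andP[d1 dm] dvd.
have dvd' : (d %| (Zp_trunc m).+2)%N by rewrite Zp_cast.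
apply/andP; split.
  apply/asboolP; split.
  - by rewrite inE /= dvdn0.
  - by rewrite inE /= Zp_cast // modn_small // dvdn1 gtn_eqF.
  - move=> a u v; rewrite !inE /= => du dv.
    rewrite /dvdn (modn_dvdm _ dvd') -modnDml (modn_dvdm _ dvd') modnDml.
    by rewrite -/(dvdn _ _) dvdn_add // dvdn_mull.
apply/eqP => /setP/(_ d%:R); rewrite !inE /= -val_eqE /= val_Zp_nat //.
by rewrite modn_small // dvdnn gtn_eqF // ltnW.
Qed.

(** The sums of products of elements of dZ_m and Z_n stay in the subgroup of the
multiples of gcd(d, n). *)
Lemma ideal_smul_sub m n d (I : {set 'Z_m}) (y : 'Z_n) : (1 < n)%N ->
  (forall x, (x \in I) = (d %| val x)%N) ->
  y \in ideal_smul n I -> (gcdn d n %| val y)%N.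
Proof.
move=> n1 IP.
have gn : (gcdn d n %| (Zp_trunc n).+2)%N by rewrite Zp_cast // dvdn_gcdr.
have gS : group_set [set y : 'Z_n | (gcdn d n %| val y)%N]%SET.
  apply/group_setP; split; first by rewrite inE /= dvdn0.
  move=> u v; rewrite !inE /= => du dv.
  by rewrite /dvdn (modn_dvdm _ gn) -/(dvdn _ _) dvdn_add.
suff : (ideal_smul n I \subset Group gS)%g.
  by move=> /fintype.subsetP H /H; rewrite inE.
rewrite gen_subG; apply/fintype.subsetP => _ /imset2P[a x aI _ ->].
move: aI; rewrite inE IP => da.
have -> : Zact a x = (val x * val a)%:R.
  by rewrite -{1}(natr_Zp x) natrM mulr_natr.
rewrite /= val_Zp_nat // /dvdn (modn_dvdm _ (dvdn_gcdr _ _)) -/(dvdn _ _).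
by rewrite dvdn_mull // (dvdn_trans (dvdn_gcdl _ _)).
Qed.

Lemma ideal_smul_mem m n d (I : {set 'Z_m}) k : (1 < m)%N -> (d < m)%N ->
  (forall x, (x \in I) = (d %| val x)%N) ->
  (d %| k)%N -> (k%:R : 'Z_n) \in ideal_smul n I.
Proof.
move=> m1 dm IP /dvdnP[q ->]; apply: mem_gen; apply/imset2P.
exists (d%:R : 'Z_m) (q%:R : 'Z_n); rewrite ?inE //.
  by rewrite IP /= val_Zp_nat // modn_small.
by rewrite /Zact /= val_Zp_nat // modn_small // natrM mulr_natr.
Qed.

(** [IZ_n] and [JZ_n] both contain the class of lcm(d, e), and all their common
elements are multiples of lcm(gcd(d, n), gcd(e, n)) = gcd(lcm(d, e), n). *)
Lemma Zn_graph_divisors m n : (1 < m)%N -> (1 < n)%N ->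
  exists gen : Zn_graph m n -> nat,
  [/\ injective gen,
      forall I, (1 < gen I < m)%N /\ (gen I %| m)%N,
      forall d, (1 < d < m)%N -> (d %| m)%N -> exists I, gen I = d
    & forall I J, adj I J = (I != J) && ~~ (n %| lcmn (gen I) (gen J))%N].
Proof.
move=> m1 n1.
have /choice[gen genP] (I : Zn_graph m n) : exists d, [/\ (1 < d < m)%N,
    (d %| m)%N & forall x, (x \in val I) = (d %| val x)%N].
  by have /andP[/asboolP cl nz] := valP I; exact: ideal_gen.
exists gen; split.
- move=> I J E; apply/val_inj/setP => x.
  by have [_ _ ->] := genP I; have [_ _ ->] := genP J; rewrite E.
- by move=> I; have [] := genP I.
- move=> d dm dvd; exists (Sub _ (dvd_ideal m1 dm dvd)).
  set I := Sub _ _; have [/andP[g1 gm] _ gP] := genP I.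
  have {}gP k : (k < m)%N -> (d %| k)%N = (gen I %| k)%N.
    move=> km; have := gP (inZp k).
    by rewrite SubK inE /= Zp_cast // modn_small.
  have /andP[_ dltm] := dm.
  by apply/eqP; rewrite eqn_dvd -gP // dvdnn gP // dvdnn.
move=> I J; congr (_ && _).
have [/andP[I1 Im] _ IP] := genP I; have [/andP[J1 Jm] _ JP] := genP J.
apply/idP/idP => [|ndvd].
- apply: contra => dvd; rewrite finset.eqEsubset; apply/andP; split.
    apply/fintype.subsetP => y; rewrite !inE.
    case/andP=> /(ideal_smul_sub n1 IP) yI /(ideal_smul_sub n1 JP) yJ.
    have nl : (n %| lcmn (gcdn (gen I) n) (gcdn (gen J) n))%N.
      rewrite -Order.NatDvd.meetUl dvdn_gcd dvdnn andbT.
      exact: dvd.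
    have ny : (n %| val y)%N by rewrite (dvdn_trans nl) // dvdn_lcm yI.
    rewrite -val_eqE /= -(modn_small (_ : val y < n)%N) //.
    by rewrite -[X in (_ < X)%N](Zp_cast n1) ltn_ord.
  by apply/fintype.subsetP => y; rewrite !inE => /eqP->; rewrite !group1.
- have yI := ideal_smul_mem n m1 Im IP (dvdn_lcml (gen I) (gen J)).
  have yJ := ideal_smul_mem n m1 Jm JP (dvdn_lcmr (gen I) (gen J)).
  apply: contra ndvd => /eqP/setP/(_ (lcmn (gen I) (gen J))%:R).
  by rewrite !inE yI yJ => /esym; rewrite -val_eqE /= val_Zp_nat.
Qed.
End Ideals.

(** * Numbers with at most five divisors *)

Section Divisors.
Local Open Scope nat_scope.

Lemma pexpn_gt0 p a : prime p -> 0 < p ^ a.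
Proof. by move=> pp; rewrite expn_gt0 prime_gt0. Qed.

Lemma logn_pfactorM p a d : prime p -> 0 < d -> ~~ (p %| d) ->
  logn p (p ^ a * d) = a.
Proof.
move=> pp d0 pd; rewrite lognM ?pexpn_gt0 // pfactorK //.
by rewrite logn_coprime ?addn0 // prime_coprime.
Qed.

(** Such divisors are the p^i d with i < b and d | m'.  With b = a + 1 all
divisors are counted; with b the valuation of n at p, the clique of p. *)
Lemma size_divisors_logn_lt p a m' b : prime p -> 0 < m' -> ~~ (p %| m') ->
  b <= a.+1 ->
  size [seq d <- divisors (p ^ a * m') | logn p d < b] = b * size (divisors m').
Proof.
move=> pp m0 pm ba.
have pam0 : 0 < p ^ a * m' by rewrite muln_gt0 pexpn_gt0.
have logE i (d : nat) : d \in divisors m' -> logn p (p ^ i * d) = i.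
  rewrite -dvdn_divisors // => dm; apply: logn_pfactorM => //.
    exact: dvdn_gt0 dm.
  by apply: contra pm => /dvdn_trans; apply.
pose f i d := p ^ i * d.
have -> : b * size (divisors m') =
    size [seq f i d | i <- iota 0 b, d <- divisors m'].
  by rewrite size_allpairs size_iota.
apply/perm_size/uniq_perm.
- by rewrite filter_uniq // divisors_uniq.
- apply: allpairs_uniq; rewrite ?iota_uniq ?divisors_uniq // => -[i d] [j e].
  case/allpairsP=> -[i' d'] [/= _ dd [-> ->]].
  case/allpairsP=> -[j' e'] [/= _ ee [-> ->]]; rewrite /f => E.
  have ij : i' = j' by rewrite -(logE i' _ dd) E logE.
  congr (_, _) => //; apply/eqP.
  by rewrite -(eqn_pmul2l (pexpn_gt0 i' pp)) E ij.
move=> e; rewrite mem_filter -dvdn_divisors //.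
apply/andP/allpairsP => [[eb ed]|].
  have e0 : 0 < e by exact: dvdn_gt0 ed.
  have [q qp eE] := pfactor_coprime pp e0.
  exists (logn p e, q); rewrite /= mem_iota eb -dvdn_divisors //; split => //.
    rewrite -(@Gauss_dvdr _ (p ^ a)) ?coprimeXr 1?coprime_sym //.
    by rewrite (dvdn_trans _ ed) // eE dvdn_mulr.
  by rewrite /f mulnC.
case=> -[i d] [/= ib dd ->]; rewrite /f logE //.
move: ib dd; rewrite mem_iota add0n -dvdn_divisors // => /= ib dd; split=> //.
by rewrite dvdn_mul // dvdn_exp2l // -ltnS (leq_trans ib).
Qed.

Lemma size_divisorsM p a m' : prime p -> 0 < m' -> ~~ (p %| m') ->
  size (divisors (p ^ a * m')) = a.+1 * size (divisors m').
Proof.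
move=> pp m0 pm; rewrite -(@size_divisors_logn_lt p a) //.
rewrite (eq_in_filter (a2 := predT)) ?filter_predT // => d.
have pam0 : 0 < p ^ a * m' by rewrite muln_gt0 pexpn_gt0.
rewrite -dvdn_divisors // => dd.
by rewrite ltnS -(logn_pfactorM a pp m0 pm) dvdn_leq_log.
Qed.

Lemma size_divisors_pfactor p a : prime p -> size (divisors (p ^ a)) = a.+1.
Proof.
move=> pp; rewrite -[p ^ a]muln1 size_divisorsM ?muln1 //.
by rewrite dvdn1; case: p pp => [|[]].
Qed.

Lemma prime_split m : 1 < m -> exists p a m',
  [/\ prime p, 0 < a, 0 < m', ~~ (p %| m') & m = p ^ a * m'].
Proof.
move=> m1; have pp := pdiv_prime m1; have m0 := ltnW m1.
have [m' cop mE] := pfactor_coprime pp m0.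
exists (pdiv m), (logn (pdiv m) m), m'; split => //.
- by rewrite logn_gt0 mem_primes pp m0 pdiv_dvd.
- by case: m' {cop} mE m0 => // ->.
- by rewrite -prime_coprime.
- by rewrite mulnC.
Qed.

(** Splitting off the full power q^k of a prime divides tau by k + 1, and 5 is
less than 2 * 2 * 2 and 3 * 2. *)
Lemma few_divisors m : 0 < m -> size (divisors m) <= 5 ->
  [\/ m = 1,
      exists q k, [/\ prime q, 0 < k <= 4 & m = q ^ k]
    | exists q r, [/\ prime q, prime r, q != r & m = q * r]].
Proof.
move=> m0; have [m1|] := ltnP 1 m; last first.
  by case: m m0 => [|[]] // *; constructor 1.
have [q [k [m' [pq k0 m'0 qm' ->]]]] := prime_split m1.
rewrite size_divisorsM //.
have [m'1|m'1] := ltnP 1 m'; last first.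
  have -> : m' = 1 by case: m' m'0 m'1 {qm'} => [|[]].
  rewrite /= muln1 => k5; constructor 2; exists q, k; split => //.
    by rewrite k0.
  by rewrite muln1.
have [r [l [m'' [pr l0 m''0 rm'' m'E]]]] := prime_split m'1.
rewrite m'E size_divisorsM // => le5.
have t1 : 0 < size (divisors m'').
  by have := divisor1 m''; case: (divisors m'').
have k1 : k = 1 by nia.
have l1 : l = 1 by nia.
have m''1 : m'' = 1.
  case: (ltnP 1 m'') => [/prime_split[u [v [w [pu v0 w0 uw E]]]]|]; last first.
    by case: m'' m''0 {m'E rm'' le5 t1} => [|[]].
  have w1 : 0 < size (divisors w) by have := divisor1 w; case: (divisors w).
  have : 2 <= v.+1 * size (divisors w) by rewrite (leq_mul (_ : 1 < v.+1) w1).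
  move: le5; rewrite E size_divisorsM // k1 l1.
  by move: (v.+1 * _) => x; clear; lia.
constructor 3; exists q, r; split => //.
  by apply: contraNneq qm' => ->; rewrite m'E l1 expn1 dvdn_mulr.
by rewrite k1 l1 m''1 !expn1 muln1.
Qed.
End Divisors.

(** * Planar graphs satisfy the divisor bound *)

Section Classification.
Local Open Scope nat_scope.

(** The divisors d of m with v_p(d) < b are not multiples of n, nor are their
pairwise lcm's, so those other than 1 span a clique. *)
Lemma planar_divisor_bound (R : realType) m n p a b m' n' :
  1 < m -> 1 < n -> planar R (Zn_graph m n) -> prime p ->
  ~~ (p %| m') -> ~~ (p %| n') -> m = p ^ a * m' -> n = p ^ b * n' -> b <= a ->
  b * size (divisors m') <= 5.
Proof.
move=> m1 n1 plan pp pm pn mE nE ba.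
have m0 := ltnW m1; have n0 := ltnW n1.
have m'0 : 0 < m' by case: m' pm {mE} => //; rewrite dvdn0.
have n'0 : 0 < n' by case: n' pn {nE} => //; rewrite dvdn0.
have [->//|b0] := posnP b.
have [gen [genI genP gen_onto adjE]] := Zn_graph_divisors m1 n1.
pose D := [seq d <- divisors m | logn p d < b].
have DP d : d \in D -> d != 1 -> (1 < d < m) /\ d %| m.
  rewrite mem_filter -dvdn_divisors // => /andP[db dm] d1; split=> //.
  rewrite ltn_neqAle eq_sym d1 (dvdn_gt0 m0 dm) /= ltn_neqAle dvdn_leq // andbT.
  by apply: contraTneq db => ->; rewrite mE logn_pfactorM // -leqNgt.
pose s := [seq I <- enum (Zn_graph m n) | logn p (gen I) < b].
have D1 : 1 \in D by rewrite mem_filter logn1 b0 divisor1.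
have Du : uniq D by rewrite filter_uniq // divisors_uniq.
have DE : size D = b * size (divisors m').
  by rewrite /D mE size_divisors_logn_lt // ltnW.
have le_s : size (rem 1 D) <= size s.
  rewrite -(size_map gen); apply: uniq_leq_size; first exact: rem_uniq.
  move=> d; rewrite mem_rem_uniq // inE => /andP[d1 dD].
  have [dm /(gen_onto _ dm)[I IE]] := DP _ dD d1.
  rewrite -IE map_f // mem_filter mem_enum andbT IE.
  by move: dD; rewrite mem_filter => /andP[].
rewrite size_rem // DE in le_s.
suff s4 : size s <= 4 by lia.
apply: (planar_clique plan).
have : pairwise (fun I J => I != J) s.
  by rewrite -uniq_pairwise filter_uniq // enum_uniq.
apply: (sub_in_pairwise (P := [pred I | logn p (gen I) < b])); last first.
  exact: filter_all.
move=> I J; rewrite !inE => Ib Jb IJ.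
rewrite adjE IJ /=; apply/negP => /(dvdn_leq_log p).
have [/andP[I1 _] _] := genP I; have [/andP[J1 _] _] := genP J.
have [I0 J0] := (ltnW I1, ltnW J1).
rewrite lcmn_gt0 I0 J0 => /(_ isT).
by rewrite nE logn_pfactorM // logn_lcm // leq_max leqNgt Ib leqNgt Jb.
Qed.

(** * The eight families *)

Definition listed_pair (m n : nat) : Prop :=
  exists p1 p2 p3 a1 a2 b1 : nat,
    [/\ prime p1, prime p2 & prime p3] /\
    [/\ p1 <> p2, p1 <> p3 & p2 <> p3] /\
    [/\ 0 < a1, 0 < a2 & 0 < b1] /\
    ([/\ m = p1 ^ a1, n = p1 ^ b1 & b1 <= 5] \/
     [/\ m = p1 ^ a1 * p2 ^ a2, n = p1 & a2 <= 4] \/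
     (m = p1 ^ a1 * p2 /\ n = p1 ^ 2) \/
     (m = p1 ^ a1 * p2 * p3 /\ n = p1) \/
     [/\ m = p1 * p2 ^ a2, n = p1 * p2 ^ 2 & a2 \in [:: 2; 3; 4]] \/
     (m = p1 * p2 * p3 /\ n = p1 * p2) \/
     [/\ m = p1 ^ a1 * p2 ^ a2, n = p1 * p2, a1 <= 4 & a2 <= 4] \/
     (m = p1 * p2 * p3 /\ n = p1 * p2 * p3)).

Lemma fresh_prime p q : exists r, [/\ prime r, p <> r & q <> r].
Proof.
have [r pqr pr] := prime_above (maxn p q).
move: pqr; rewrite gtn_max => /andP[pr' qr].
by exists r; split => // E; [move: pr' | move: qr]; rewrite E ltnn.
Qed.

Lemma prime_ndvd p q : prime p -> prime q -> p != q -> ~~ (p %| q).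
Proof. by move=> pp pq; rewrite dvdn_prime2. Qed.

Lemma prime_ndvd_exp p q a : prime p -> prime q -> p != q -> ~~ (p %| q ^ a).
Proof.
move=> pp pq npq; rewrite -prime_coprime // coprimeXr // prime_coprime //.
exact: prime_ndvd.
Qed.

Lemma prime_ndvd_mul p d e : prime p -> ~~ (p %| d) -> ~~ (p %| e) ->
  ~~ (p %| d * e).
Proof. by move=> pp pd pe; rewrite Euclid_dvdM // negb_or pd. Qed.

Lemma prime_ndvd1 p : prime p -> ~~ (p %| 1).
Proof. by move=> pp; rewrite dvdn1; case: p pp => [|[]]. Qed.

Lemma dvdn_prime_mul p q d : prime p -> prime q -> d %| p * q ->
  [\/ d = 1, d = p, d = q | d = p * q].
Proof.
move=> pp pq; have [pd|npd] := boolP (p %| d).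
  have [e ->] := dvdnP pd; rewrite mulnC dvdn_pmul2l ?prime_gt0 //.
  case/primeP: pq => _ /[apply] /orP[]/eqP->.
    by rewrite muln1; constructor 2.
  by constructor 4.
rewrite Gauss_dvdr; last by rewrite coprime_sym prime_coprime.
case/primeP: pq => _ /[apply] /orP[]/eqP->; first by constructor 1.
by constructor 3.
Qed.

Lemma small_product b k : 0 < b -> 0 < k -> b * k.+1 <= 5 ->
  b = 1 \/ b = 2 /\ k = 1.
Proof. case: b => [|[|[|b]]]; case: k => [|[|k]]; lia. Qed.

Lemma small_products a b k l : 0 < b <= a -> 0 < l <= k ->
  b * k.+1 <= 5 -> l * a.+1 <= 5 ->
  [\/ b = 1 /\ l = 1, [/\ b = 2, k = 1 & l = 1] | [/\ b = 1, l = 2 & a = 1]].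
Proof.
move=> /andP[b0 ba] /andP[l0 lk] bk la.
have [b1|[b2 k1]] := small_product b0 (leq_trans l0 lk) bk.
- have [l1|[l2 a1]] := small_product l0 (leq_trans b0 ba) la.
    by constructor 1.
  by constructor 3.
by constructor 2; split=> //; apply/eqP; rewrite eqn_leq l0 -k1 lk.
Qed.

(** The bound is applied first to a prime p dividing n, which limits m' to three
shapes, then to the other prime divisors of n, which limits a. *)
Lemma bounded_listed m n : 1 < n -> n %| m -> 0 < m ->
  (forall p a b m' n', prime p -> ~~ (p %| m') -> ~~ (p %| n') ->
     m = p ^ a * m' -> n = p ^ b * n' -> b <= a ->
     b * size (divisors m') <= 5) ->
  listed_pair m n.
Proof.
move=> n1 nm m0 bound.
have [p [b [n' [pp b0 n'0 pn nE]]]] := prime_split n1.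
have [m' /= cop mE] := pfactor_coprime pp m0.
move: mE; rewrite mulnC; set a := logn p m => mE.
have pm : ~~ (p %| m') by rewrite -prime_coprime.
have m'0 : 0 < m' by case: m' pm {mE cop} => //; rewrite dvdn0.
have ba : b <= a by rewrite /a -(logn_pfactorM b pp n'0 pn) -nE dvdn_leq_log.
have nm' : n' %| m'.
  rewrite -(@Gauss_dvdr n' (p ^ a)); last first.
    by rewrite coprimeXr // coprime_sym prime_coprime.
  by rewrite -mE (dvdn_trans _ nm) // nE dvdn_mull.
have bnd := bound _ _ _ _ _ pp pm pn mE nE ba.
have a0 : 0 < a by rewrite (leq_trans b0).
have t5 : size (divisors m') <= 5 by rewrite (leq_trans _ bnd) // leq_pmull.
clearbody a; clear n1 nm m0 cop.
case: (few_divisors m'0 t5) =>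
  [m'1|[q [k [pq /andP[k0 k4] m'E]]]|[q [r [pq pr qr m'E]]]].
- have n'1 : n' = 1 by apply/eqP; rewrite -dvdn1 -m'1.
  have [q [pq pq' _]] := fresh_prime p p.
  have [r [pr pr' qr]] := fresh_prime p q.
  exists p, q, r, a, 1, b; do 3!split => //; left.
  rewrite mE nE n'1 m'1 !muln1; split => //.
  by move: bnd; rewrite m'1 muln1.
- have npq : p != q.
    by apply: contraNneq pm => ->; rewrite m'E dvdn_exp.
  have pNq := elimN eqP npq.
  have [r [pr pr' qr]] := fresh_prime p q.
  have qNp : q <> p by move=> E; apply: pNq.
  move: nm' bnd; rewrite m'E size_divisors_pfactor //.
  move=> /(dvdn_pfactor _ _ pq)[l lk n'E] bnd.
  rewrite m'E in mE; rewrite n'E in nE.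
  have qp a' : ~~ (q %| p ^ a') by apply: prime_ndvd_exp; rewrite // eq_sym.
  have mE' : m = q ^ k * p ^ a by rewrite mE mulnC.
  have nE' : n = q ^ l * p ^ b by rewrite nE mulnC.
  have := bound _ _ _ _ _ pq (qp _) (qp _) mE' nE' lk.
  rewrite size_divisors_pfactor // => bnd'.
  have [l0|l0] := posnP l.
    move: nE; rewrite l0 muln1 => nE.
    have [b1|[b2 k1]] := small_product b0 k0 bnd.
      exists p, q, r, a, k, 1; do 3!split => //; right; left.
      by rewrite mE nE b1 expn1.
    exists p, q, r, a, k, 1; do 3!split => //; do 2!right; left.
    by rewrite mE nE b2 k1 expn1.
  have b0a : 0 < b <= a by rewrite b0.
  have l0k : 0 < l <= k by rewrite l0.
  case: (small_products b0a l0k bnd bnd') => [[b1 l1]|[b2 k1 l1]|[b1 l2 a1]].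
  + exists p, q, r, a, k, 1; do 3!split => //; do 6!right; left.
    rewrite mE nE b1 l1 !expn1; split => //.
    by move: bnd'; rewrite l1; lia.
  + exists q, p, r, k, a, 1; do 3!split => //; do 4!right; left.
    rewrite mE nE b2 k1 l1 !expn1 mulnC (mulnC (p ^ 2)); split => //.
    by rewrite !inE; move: bnd' ba; rewrite l1 b2; lia.
  + exists p, q, r, a, k, 1; do 3!split => //; do 4!right; left.
    rewrite mE nE b1 l2 a1 !expn1; split => //.
    by rewrite !inE; move: bnd lk; rewrite l2 b1; lia.
- have npq : p != q by apply: contraNneq pm => ->; rewrite m'E dvdn_mulr.
  have npr : p != r by apply: contraNneq pm => ->; rewrite m'E dvdn_mull.
  have [pNq pNr] := (elimN eqP npq, elimN eqP npr).
  have qNr := elimN eqP qr.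
  have rNq : r <> q by move=> E; apply: qNr.
  have qNp : q != p by rewrite eq_sym.
  have rNp : r != p by rewrite eq_sym.
  have rNq' : r != q by rewrite eq_sym.
  have tE : size (divisors m') = 4.
    rewrite m'E -(expn1 q) size_divisorsM // ?prime_gt0 //; last first.
      exact: prime_ndvd.
    by rewrite -(expn1 r) size_divisors_pfactor.
  have b1 : b = 1 by move: b0 bnd; rewrite tE; clear; lia.
  rewrite b1 expn1 in nE; rewrite m'E in mE nm'.
  (* the bound at a second prime s of n, t being the third prime of m, reads
     (a + 1) * 2 <= 5 *)
  have a1 s t n'' : prime s -> prime t -> s != p -> s != t -> t != p ->
      m = p ^ a * (s * t) -> n = p * (s * n'') -> ~~ (s %| n'') -> a = 1.
    move=> ps pt sp st tp mE' nE' sn''.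
    have mE'' : m = s ^ 1 * (p ^ a * t) by rewrite mE' mulnCA.
    have nE'' : n = s ^ 1 * (p * n'') by rewrite nE' mulnCA.
    have sNp : ~~ (s %| p) by apply: prime_ndvd.
    have := bound s 1 1 _ _ ps _ _ mE'' nE'' (leqnn 1).
    rewrite size_divisorsM ?prime_gt0 //; last first.
      by apply: prime_ndvd; rewrite // eq_sym.
    rewrite -(expn1 t) size_divisors_pfactor // => bnd1.
    have : 1 * (a.+1 * 2) <= 5.
      apply: bnd1; apply: prime_ndvd_mul => //; first exact: prime_ndvd_exp.
      exact: prime_ndvd.
    by move: a0; clear; lia.
  case: (dvdn_prime_mul pq pr nm') => n'E; rewrite n'E in nE.
  + exists p, q, r, a, 1, 1; do 3!split => //; do 3!right; left.
    by rewrite mE nE muln1 mulnA.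
  + exists p, q, r, 1, 1, 1; do 3!split => //; do 5!right; left.
    by rewrite mE nE (a1 q r 1) ?muln1 ?prime_ndvd1 // expn1 mulnA.
  + exists p, r, q, 1, 1, 1; do 3!split => //; do 5!right; left.
    rewrite mE nE (a1 r q 1) ?muln1 ?prime_ndvd1 // 1?(mulnC r) //.
    by rewrite expn1 (mulnC q) mulnA.
  + exists p, q, r, 1, 1, 1; do 3!split => //; do 7!right.
    by rewrite mE nE (a1 q r r) ?prime_ndvd // expn1 mulnA.
Qed.
End Classification.

(** * Drawings of the eight families *)

Section Drawings.
Local Open Scope nat_scope.

(** The divisor p^i q^j r^k of m is labelled by (i, j, k). *)
Definition exponents : Type := nat * nat * nat.

(** With [B] the exponents of n: the labelled divisor is not a multiple of n. *)
Definition deficient (B x : exponents) : bool :=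
  [|| x.1.1 < B.1.1, x.1.2 < B.1.2 | x.2 < B.2].

Definition joined (B x y : exponents) : bool :=
  deficient B (maxn x.1.1 y.1.1, maxn x.1.2 y.1.2, maxn x.2 y.2).

(** The non-isolated vertices, in lexicographic order.  The strict bounds [N] on
their exponents are separate data because the exponents of isolated vertices
may be arbitrarily large within a family. *)
Definition core (B N : exponents) : seq exponents :=
  [seq x <- [seq (ij, k) | ij <- [seq (i, j) | i <- iota 0 N.1.1,
                                               j <- iota 0 N.1.2],
                           k <- iota 0 N.2]
   | deficient B x & x != (0, 0, 0)].

Definition table (s : seq exponents) (pts : seq (nat * nat)) (x : exponents) :
    int * int :=
  let pt := nth (0, 0) pts (index x s) in (Posz pt.1, Posz pt.2).

(** The drawing is computed for exponents A', B', C' of n that may be larger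
than the actual ones: increasing them only adds vertices and edges, so that
a single table serves a whole family. *)
Lemma planar_exponents (R : realType) p q r A' B' C' A B C pts
    m n a b c a' b' c' :
  prime p -> prime q -> prime r -> p != q -> p != r -> q != r ->
  1 < m -> 1 < n ->
  m = p ^ a * q ^ b * r ^ c -> n = p ^ a' * q ^ b' * r ^ c' ->
  [&& a' <= A', b' <= B' & c' <= C'] ->
  (forall i j k, i <= a -> j <= b -> k <= c -> [|| i < a', j < b' | k < c'] ->
    [&& i < A, j < B & k < C]) ->
  straight_ok (core (A', B', C') (A, B, C))
    (table (core (A', B', C') (A, B, C)) pts) (joined (A', B', C')) ->
  planar R (Zn_graph m n).
Proof.
move=> pp pq pr npq npr nqr m1 n1 mE nE le_n box ok.
have [gen [genI genP _ adjE]] := Zn_graph_divisors m1 n1.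
have m0 := ltnW m1; have n0 := ltnW n1.
have logE s x y z : logn s (p ^ x * q ^ y * r ^ z) =
    x * (s == p) + y * (s == q) + z * (s == r).
  by rewrite !lognM ?muln_gt0 ?pexpn_gt0 // !lognX !logn_prime.
have divE d : d %| m -> d = p ^ logn p d * q ^ logn q d * r ^ logn r d.
  move=> dm; apply: eqn_from_log.
  - exact: dvdn_gt0 dm.
  - by rewrite !muln_gt0 !pexpn_gt0.
  move=> s; rewrite logE; have [->|sp] := eqVneq s p.
    by rewrite (negbTE npq) (negbTE npr) muln1 !muln0 !addn0.
  have [->|sq] := eqVneq s q.
    by rewrite (negbTE nqr) muln1 !muln0 add0n addn0.
  have [->|sr] := eqVneq s r; first by rewrite muln1 !muln0.
  have := dvdn_leq_log s m0 dm.
  rewrite mE logE (negbTE sp) (negbTE sq) (negbTE sr) !muln0 leqn0 => /eqP->.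
  by [].
have logm d : d %| m -> [/\ logn p d <= a, logn q d <= b & logn r d <= c].
  move=> dm; move: (dvdn_leq_log p m0 dm) (dvdn_leq_log q m0 dm).
  move: (dvdn_leq_log r m0 dm); rewrite mE !logE !eqxx.
  rewrite !(eq_sym r) !(eq_sym q p) (negbTE npq) (negbTE npr) (negbTE nqr).
  by rewrite !muln1 !muln0 !addn0 !add0n.
pose lab I : exponents := (logn p (gen I), logn q (gen I), logn r (gen I)).
have g0 I : 0 < gen I by have [/andP[/ltnW]] := genP I.
have lab_inj : injective lab.
  move=> I J [e1 e2 e3]; apply: genI.
  have [_ dI] := genP I; have [_ dJ] := genP J.
  by rewrite (divE _ dI) (divE _ dJ) e1 e2 e3.
apply: (@planar_straight R (Zn_graph m n) _ lab _ _ _ lab_inj _ ok).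
move=> I J; rewrite adjE => /andP[_ ndvd].
have def : [|| maxn (logn p (gen I)) (logn p (gen J)) < a',
   maxn (logn q (gen I)) (logn q (gen J)) < b'
   | maxn (logn r (gen I)) (logn r (gen J)) < c'].
  apply: contraR ndvd; rewrite !negb_or -!leqNgt -!logn_lcm // nE.
  move=> /and3P[ha hb hc].
  have l0 : 0 < lcmn (gen I) (gen J) by rewrite lcmn_gt0 !g0.
  have cop s t x y : prime s -> prime t -> s != t -> coprime (s ^ x) (t ^ y).
    by move=> ps pt st; rewrite coprimeXl // coprimeXr // prime_coprime //
      dvdn_prime2.
  have copr : coprime (p ^ a' * q ^ b') (r ^ c') by rewrite coprimeMl !cop.
  by rewrite (Gauss_dvd _ copr) (Gauss_dvd _ (cop p q _ _ pp pq npq))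
    !pfactor_dvdn // ha hb hc.
have core_mem x y z : [&& x < A, y < B & z < C] ->
    [|| x < A', y < B' | z < C'] -> (x, y, z) != (0, 0, 0) ->
    (x, y, z) \in core (A', B', C') (A, B, C).
  move=> /and3P[xA yB zC] xyz nz; rewrite mem_filter /deficient xyz nz /=.
  apply/allpairsP; exists ((x, y), z); split => //=; last by rewrite mem_iota.
  by apply/allpairsP; exists (x, y); split => //=; rewrite mem_iota.
have in_core K : [|| logn p (gen K) < a', logn q (gen K) < b'
   | logn r (gen K) < c'] -> lab K \in core (A', B', C') (A, B, C).
  have [/andP[K1 _] Km] := genP K => dK.
  have [pa qb rc] := logm _ Km.
  have [da db dc] : [/\ a' <= A', b' <= B' & c' <= C'] by apply/and3P.
  apply: core_mem; first exact: box.
    case/or3P: dK => /leq_trans lt; apply/or3P.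
    - by constructor 1; exact: lt.
    - by constructor 2; exact: lt.
    - by constructor 3; exact: lt.
  apply: contraTneq K1 => -[e1 e2 e3]; rewrite (divE _ Km) e1 e2 e3.
  by rewrite !expn0.
have [da db dc] : [/\ a' <= A', b' <= B' & c' <= C'] by apply/and3P.
apply/and3P; split.
- apply: in_core.
  by case/or3P: def; rewrite gtn_max => /andP[-> _]; rewrite ?orbT.
- apply: in_core.
  by case/or3P: def; rewrite gtn_max => /andP[_ ->]; rewrite ?orbT.
rewrite /joined /deficient /=.
case/or3P: def => /leq_trans lt.
- by rewrite lt.
- by rewrite lt ?orbT.
- by rewrite lt ?orbT.
Qed.

(** The tables list the positions in the order of [core].  Exponents equal to 0
absorb the auxiliary primes of the families with fewer than three of them. *)
Lemma listed_planar (R : realType) m n : 1 < m -> 1 < n ->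
  listed_pair m n -> planar R (Zn_graph m n).
Proof.
move=> m1 n1 [p [q [r [a [b [c]]]]]].
move=> [[pp pq pr] [[/eqP npq /eqP npr /eqP nqr] [[a0 b0 c0]]]].
have planE A1 B1 C1 A2 B2 C2 pts x y z u v w := @planar_exponents R p q r
  A1 B1 C1 A2 B2 C2 pts m n x y z u v w
  pp pq pr npq npr nqr m1 n1.
move=> [[mE nE c5]|[[mE nE b4]|[[mE nE]|[[mE nE]|[[mE nE b24]|[[mE nE]|
  [[mE nE a4 b4]|[mE nE]]]]]]]].
- apply: (planE 5 0 0 5 1 1 [:: (1,0); (1,1); (0,2); (2,1)] a 0 0 c 0 0).
  + by rewrite mE !muln1.
  + by rewrite nE !muln1.
  + by rewrite c5.
  + by move=> i j k; move: c5; clear; lia.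
  + by vm_compute.
- apply: (planE 1 0 0 1 5 1 [:: (0,0); (2,0); (1,2); (1,1)] a b 0 1 0 0).
  + by rewrite mE !muln1.
  + by rewrite nE !muln1.
  + by [].
  + by move=> i j k; move: b4; clear; lia.
  + by vm_compute.
- apply: (planE 2 0 0 2 2 1 [:: (1,2); (2,0); (0,0)] a 1 0 2 0 0).
  + by rewrite mE !muln1.
  + by rewrite nE !muln1.
  + by [].
  + by move=> i j k; clear; lia.
  + by vm_compute.
- apply: (planE 1 0 0 1 2 2 [:: (1,1); (0,2); (0,1)] a 1 1 1 0 0).
  + by rewrite mE.
  + by rewrite nE !muln1.
  + by [].
  + by move=> i j k; clear; lia.
  + by vm_compute.
- apply: (planE 1 2 0 2 5 1
    [:: (1,2); (3,1); (2,1); (2,0); (1,3); (3,3)]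
    1 b 0 1 2 0).
  + by rewrite mE !muln1.
  + by rewrite nE !muln1.
  + by [].
  + by move=> i j k; move: b24; rewrite !inE; clear; lia.
  + by vm_compute.
- apply: (planE 1 1 0 2 2 2 [:: (2,0); (1,0); (0,1); (2,1); (1,2)] 1 1 1 1 1 0).
  + by rewrite mE.
  + by rewrite nE !muln1.
  + by [].
  + by move=> i j k; clear; lia.
  + by vm_compute.
- apply: (planE 1 1 0 5 5 1
    [:: (1,1); (3,0); (1,4); (0,1); (2,4); (4,3); (3,3); (4,0)]
    a b 0 1 1 0).
  + by rewrite mE !muln1.
  + by rewrite nE !muln1.
  + by [].
  + by move=> i j k; move: a4 b4; clear; lia.
  + by vm_compute.
- apply: (planE 1 1 1 2 2 2
    [:: (0,1); (1,0); (0,0); (2,2); (1,2); (2,1)]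
    1 1 1 1 1 1).
  + by rewrite mE.
  + by rewrite nE.
  + by [].
  + by move=> i j k; clear; lia.
  + by vm_compute.
Qed.
End Drawings.

Theorem theorem1 (R : realType) (m n : nat) (m_gt1 : 1 < m) (n_gt1 : 1 < n)
    (mod_mn : Z_module m n) :
  planar R (Zn_graph m n) <->
  exists p1 p2 p3 a1 a2 b1 : nat,
    [/\ prime p1, prime p2 & prime p3] /\
    [/\ p1 <> p2, p1 <> p3 & p2 <> p3] /\
    [/\ 0 < a1, 0 < a2 & 0 < b1] /\
    ([/\ m = p1 ^ a1, n = p1 ^ b1 & b1 <= 5] \/
     [/\ m = p1 ^ a1 * p2 ^ a2, n = p1 & a2 <= 4] \/
     (m = p1 ^ a1 * p2 /\ n = p1 ^ 2) \/
     (m = p1 ^ a1 * p2 * p3 /\ n = p1) \/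
     [/\ m = p1 * p2 ^ a2, n = p1 * p2 ^ 2 & a2 \in [:: 2; 3; 4]] \/
     (m = p1 * p2 * p3 /\ n = p1 * p2) \/
     [/\ m = p1 ^ a1 * p2 ^ a2, n = p1 * p2, a1 <= 4 & a2 <= 4] \/
     (m = p1 * p2 * p3 /\ n = p1 * p2 * p3)).
Proof.
have nm := (Z_moduleP m_gt1 n_gt1).1 mod_mn.
split; last exact: listed_planar.
move=> plan; apply: (bounded_listed n_gt1 nm (ltnW m_gt1)).
move=> p a b m' n' pp pm pn mE nE ba.
exact: (planar_divisor_bound m_gt1 n_gt1 plan pp pm pn mE nE ba).
Qed.
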